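(* Let $F$ be a commutative field, $1\le h\le n-1$, and let $\chi:\Gamma(n,h-1,F)\to\mathrm{PG}(n,F)^*$ be a linear mapping with non-empty domain satisfying the null property $U\subseteq U^\chi$ for all $U\in\mathbb D(\chi)$. Then there is a unique linear complex $K$ of $h$-subspaces of $\mathrm{PG}(n,F)$ such that $\chi=\uparrow K$.
   Context: A $d$-subspace is a projective subspace of dimension $d$. Grassmannian $\Gamma(n,k,F)$: points are $k$-subspaces, lines are pencils $\{X:U\subset X\subset W,\dim X=k\}$ with $\dim U=k-1$, $\dim W=k+1$. $\mathrm{PG}(n,F)^*$ is the dual projective space (points = hyperplanes). A partial map $\chi$ has domain $\mathbb D(\chi)$, exceptional set $\mathbb A(\chi)$ (the complement), and $\phi^\chi=\{X^\chi:X\in\phi\cap\mathbb D(\chi)\}$; it is a linear mapping if for each line $\ell$ exactly one holds: (i) $\ell^\chi$ is a line and $\chi$ maps $\ell$ bijectively onto it; (ii) $\ell^\chi$ is one point and $|\ell\cap\mathbb A(\chi)|=1$; (iii) $\ell\subseteq\mathbb A(\chi)$. A linear complex of $h$-subspaces is the set of $h$-subspaces whose Plücker image ($F(v_0\wedge\cdots\wedge v_h)$ for a basis $v_0,\dots,v_h$) lies in a fixed hyperplane of $\mathbb P(\bigwedge^{h+1}F^{n+1})$. For such $K$, an $(h-1)$-subspace $U$ is singular if all $h$-subspaces through $U$ lie in $K$; otherwise there is a unique hyperplane $E$ (polar hyperplane) such that an $h$-subspace $X\supseteq U$ is in $K$ iff $X\subseteq E$. $\uparrow K$ is the partial map with exceptional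 set the singular $(h-1)$-subspaces, sending each non-singular $U$ to its polar hyperplane. *)

(* Defs.v *)
(* Projective space PG(n,F) is modelled by the vector space
   F^(n+1) = 'rV[F]_n.+1 ; a projective d-subspace is a vspace of dimension d+1. *)
From mathcomp Require Import all_boot all_order all_algebra.

Set Implicit Arguments.
Unset Strict Implicit.
Unset Printing Implicit Defensive.

Import GRing.Theory.
Local Open Scope ring_scope.

Section Defs.
Variables (F : fieldType) (n h : nat).
(* h is the parameter of the paper: chi is defined on (h-1)-subspaces
   (vector dimension h) and K consists of h-subspaces (vector dimension h+1). *)

Local Notation sub := {vspace 'rV[F]_n.+1}.

(* a partial map Gamma(n,h-1,F) -> PG(n,F)^* : None = exceptional *)
Definition pmap := sub -> option sub.

(* lines of Gamma(n,h-1,F): pencils {X : U <= X <= W, dim X = h} *)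
Definition gline (U W : sub) : Prop :=
  \dim U = h.-1 /\ \dim W = h.+1 /\ (U <= W)%VS.

Definition pencil (U W X : sub) : Prop :=
  \dim X = h /\ (U <= X)%VS /\ (X <= W)%VS.

(* (i): image is a line of PG(n,F)^* (all hyperplanes through an
   (n-2)-subspace S) and chi maps the pencil bijectively onto it *)
Definition case_i (chi : pmap) (U W : sub) : Prop :=
  exists S : sub, \dim S = n.-1 /\
    (forall X, pencil U W X -> exists E, chi X = Some E /\ (S <= E)%VS) /\
    (forall X Y E, pencil U W X -> pencil U W Y ->
        chi X = Some E -> chi Y = Some E -> X = Y) /\
    (forall E : sub, \dim E = n -> (S <= E)%VS ->
        exists X, pencil U W X /\ chi X = Some E).

Definition case_ii (chi : pmap) (U W : sub) : Prop :=
  (exists E, (exists X, pencil U W X /\ chi X = Some E) /\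
     forall X E', pencil U W X -> chi X = Some E' -> E' = E) /\
  (exists X, pencil U W X /\ chi X = None /\
     forall Y, pencil U W Y -> chi Y = None -> Y = X).

Definition case_iii (chi : pmap) (U W : sub) : Prop :=
  forall X, pencil U W X -> chi X = None.

Definition linear_mapping (chi : pmap) : Prop :=
  forall U W, gline U W ->
    (case_i chi U W \/ case_ii chi U W \/ case_iii chi U W) /\
    ~ (case_i chi U W /\ case_ii chi U W) /\
    ~ (case_i chi U W /\ case_iii chi U W) /\
    ~ (case_ii chi U W /\ case_iii chi U W).

Definition plucker (X : sub) (S : {set 'I_n.+1}) : F :=
  \det (\matrix_(i < h.+1, j < h.+1)
          ((nth 0 (vbasis X) i) 0 (nth ord0 (enum S) j))).

(* linear complex of h-subspaces: Pluecker image in a fixed hyperplane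
   sum_S c_S p_S = 0 of P(wedge^(h+1) F^(n+1)) (c nonzero) *)
Definition linear_complex (K : sub -> Prop) : Prop :=
  exists c : {set 'I_n.+1} -> F,
    (exists S : {set 'I_n.+1}, #|S| = h.+1 /\ c S != 0) /\
    forall X : sub, K X <->
      (\dim X = h.+1 /\
       \sum_(S : {set 'I_n.+1} | #|S| == h.+1) c S * plucker X S = 0).

Definition singular (K : sub -> Prop) (U : sub) : Prop :=
  forall X : sub, \dim X = h.+1 -> (U <= X)%VS -> K X.

Definition polar (K : sub -> Prop) (U E : sub) : Prop :=
  \dim E = n /\
  forall X : sub, \dim X = h.+1 -> (U <= X)%VS -> (K X <-> (X <= E)%VS).

Definition is_up (chi : pmap) (K : sub -> Prop) : Prop :=
  forall U : sub, \dim U = h ->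
    (chi U = None <-> singular K U) /\
    (forall E, chi U = Some E -> polar K U E).

End Defs.

(* Main.v *)
(** Call an h-subspace U good for an (h+1)-dimensional X containing it if chi U is
    undefined or contains X.  By linearity on the pencils inside X, goodness does not
    depend on U, so "s is free and its span is not good" is a symmetric condition N on
    (h+1)-tuples s of vectors; by the null property, in each argument it is the
    non-vanishing of a linear functional.  Any such condition is the non-vanishing of an
    alternating multilinear form f, by induction on the number of arguments: the forms
    f_z given by N(z, ...) are rescaled by comparison with one fixed f_v so that
    f_z(x, ...) = - f_x(z, ...), which makes them linear in z.  Expanding f in minors
    exhibits the equation of the linear complex. *)

Require Import Defs.
From Stdlib Require Import Classical ClassicalEpsilon.
From mathcomp Require Import all_boot all_order all_algebra.
From mathcomp Require Import ring.

Set Implicit Arguments.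
Unset Strict Implicit.
Unset Printing Implicit Defensive.

Import GRing.Theory.
Local Open Scope ring_scope.

(** * Linear forms compared through their zero sets *)

Section ScalarForms.
Variables (F : fieldType) (V : lmodType F).
Implicit Types (A B C : V -> F) (x y : V).

Lemma scalar_formD A x y : scalar A -> A (x + y) = A x + A y.
Proof. by move=> hA; rewrite -[x in LHS]scale1r hA mul1r. Qed.

Lemma scalar_form0 A : scalar A -> A 0 = 0.
Proof. by move=> hA; apply: (addrI (A 0)); rewrite -scalar_formD // !addr0. Qed.

Lemma scalar_formZ A a x : scalar A -> A (a *: x) = a * A x.
Proof. by move=> hA; rewrite -[a *: x]addr0 hA scalar_form0 // addr0. Qed.

Lemma scalar_formN A x : scalar A -> A (- x) = - A x.
Proof. by move=> hA; rewrite -scaleN1r scalar_formZ // mulN1r. Qed.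

Lemma scalar_form_sum A (I : Type) (r : seq I) (P : pred I) (E : I -> V) :
  scalar A -> A (\sum_(i <- r | P i) E i) = \sum_(i <- r | P i) A (E i).
Proof.
move=> hA; apply: (big_morph A) => [x y|]; first exact: scalar_formD.
exact: scalar_form0.
Qed.

(** Subtracting from [x] the multiple of [x0] that kills [B] leaves a zero of [B], hence of [A]. *)
Lemma proportional_forms A B x0 :
    scalar A -> scalar B -> (forall x, (A x != 0) = (B x != 0)) -> B x0 != 0 ->
  forall x, A x = A x0 / B x0 * B x.
Proof.
move=> hA hB AB nz x; pose y := x - (B x / B x0) *: x0.
have /eqP : A y == 0.
  apply/negPn; rewrite AB negbK /y scalar_formD // scalar_formN //.
  by rewrite scalar_formZ // divfK // subrr.
rewrite /y scalar_formD // scalar_formN // scalar_formZ // => /eqP.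
rewrite subr_eq0 => /eqP ->; field; exact: nz.
Qed.

(** If [a] and [b] both fail, their sum works. *)
Lemma common_nonzero2 A B a b : scalar A -> scalar B -> A a != 0 -> B b != 0 ->
  exists x, A x != 0 /\ B x != 0.
Proof.
move=> hA hB nA nB; have [Ba|Ba] := eqVneq (B a) 0; last by exists a.
have [Ab|Ab] := eqVneq (A b) 0; last by exists b.
by exists (a + b); rewrite !scalar_formD // Ba Ab addr0 add0r.
Qed.

(** The conditions on [u] say that [F] has a third element, so one of [0], [1], [u] is left. *)
Lemma avoid2 (u p q : F) : u != 0 -> u != 1 -> exists l, l != p /\ l != q.
Proof.
move=> u0 u1.
have [p0|p0] := eqVneq 0 p; have [q0|q0] := eqVneq 0 q; try by exists 0.
- by exists 1; rewrite -p0 -q0 oner_neq0.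
- have [q1|q1] := eqVneq 1 q; last by exists 1; rewrite -p0 oner_neq0.
  by exists u; rewrite -p0 -q1.
have [p1|p1] := eqVneq 1 p; last by exists 1; rewrite -q0 oner_neq0.
by exists u; rewrite -q0 -p1.
Qed.

(** When [C d = 0], the form [C] is constant along [l *: d + c], while [A] and [B] vanish once each.
    Over two elements this fails for distinct nonzero [A], [B] and [C = A + B]; hence [u]. *)
Lemma common_nonzero3 A B C (u : F) a b c : u != 0 -> u != 1 ->
    scalar A -> scalar B -> scalar C -> A a != 0 -> B b != 0 -> C c != 0 ->
  exists x, [/\ A x != 0, B x != 0 & C x != 0].
Proof.
move=> u0 u1 hA hB hC nA nB nC.
have [d [Ad Bd]] := common_nonzero2 hA hB nA nB.
have [Cd|Cd] := eqVneq (C d) 0; last by exists d.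
have [l [lA lB]] := avoid2 (- A c / A d) (- B c / B d) u0 u1.
exists (l *: d + c); rewrite hA hB hC Cd mulr0 add0r; split=> //.
  by rewrite addr_eq0; apply: contraNneq lA => <-; rewrite mulfK.
by rewrite addr_eq0; apply: contraNneq lB => <-; rewrite mulfK.
Qed.

(** If [A x = C x = 0] but [B x] is nonzero, the line through [v] in direction [x] avoids the kernel
    of [C], and [A] is constant on it. As [B] has a zero there, [A v = 0], so [B v = 0], and [x + v]
    contradicts the hypothesis. *)
Lemma same_zeros_off_kernel A B C v : scalar A -> scalar B -> scalar C -> C v != 0 ->
    (forall x, C x != 0 -> (A x != 0) = (B x != 0)) ->
  forall x, (A x != 0) = (B x != 0).
Proof.
suff W A' B' : scalar A' -> scalar B' -> scalar C -> C v != 0 ->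
    (forall x, C x != 0 -> (A' x != 0) = (B' x != 0)) ->
    forall x, B' x != 0 -> A' x != 0.
  move=> hA hB hC Cv AB x; apply/idP/idP; last exact: W.
  by apply: (W B A) => // y Cy; rewrite AB.
move=> hA hB hC Cv AB x Bx; apply/negP => /eqP Ax.
have [Cx|Cx] := eqVneq (C x) 0; last by move: Bx; rewrite -AB // Ax eqxx.
have Av : A' v = 0.
  pose y := - (B' v / B' x) *: x + v.
  have Cy : C y != 0 by rewrite /y hC Cx mulr0 add0r.
  have By : B' y = 0 by rewrite /y hB mulNr divfK // addNr.
  by move: (AB y Cy); rewrite By eqxx => /negbFE/eqP; rewrite /y hA Ax mulr0 add0r.
have Bv : B' v = 0 by move: (AB v Cv); rewrite Av eqxx => /esym/negbFE/eqP.
have Cxv : C (x + v) != 0 by rewrite scalar_formD // Cx add0r.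
by move: (AB _ Cxv); rewrite !scalar_formD // Ax Av Bv !addr0 eqxx (negPf Bx).
Qed.

End ScalarForms.

(** * Multilinear forms on sequences of vectors *)

Section MultilinearForms.
Variables (F : fieldType) (V : lmodType F).
Implicit Types (f g : seq V -> F) (s t : seq V) (x y : V).

(** Only sequences of length [k] are constrained; recursion on the head suits the inductions on
    [k]. *)
Fixpoint multilinear k f : Prop :=
  if k is k'.+1 then (forall s, size s = k' -> scalar (fun x => f (x :: s))) /\
                     (forall x, multilinear k' (fun s => f (x :: s)))
  else True.

Lemma multilinearZ k a f : multilinear k f -> multilinear k (fun s => a * f s).
Proof.
elim: k f => //= k IH f [f1 f2]; split=> [s sk b x y|x]; last exact: IH.
by rewrite f1 // mulrDr mulrCA.
Qed.

Lemma multilinearD k f g : multilinear k f -> multilinear k g ->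
  multilinear k (fun s => f s + g s).
Proof.
elim: k f g => //= k IH f g [f1 f2] [g1 g2]; split=> [s sk b x y|x]; last exact: IH.
by rewrite f1 // g1 // mulrDr addrACA.
Qed.

Lemma multilinear0 k : multilinear k (fun=> 0).
Proof. by elim: k => //= k IH; split=> // s _ a x y; rewrite mulr0 addr0. Qed.

Lemma multilinear_ext k f g : (forall s, size s = k -> f s = g s) ->
  multilinear k f -> multilinear k g.
Proof.
elim: k f g => //= k IH f g fg [f1 f2]; split=> [s sk a x y|x].
  by rewrite -!fg /= ?sk // f1.
by apply: IH (f2 x) => s sk; rewrite fg //= sk.
Qed.

Lemma multilinear_sum k (I : Type) (r : seq I) (P : pred I) (f : I -> seq V -> F) :
  (forall i, P i -> multilinear k (f i)) ->
  multilinear k (fun s => \sum_(i <- r | P i) f i s).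
Proof.
move=> fk; elim: r => [|i r IH].
  by apply: multilinear_ext (multilinear0 k) => s _; rewrite big_nil.
case Pi: (P i); last by apply: multilinear_ext IH => s _; rewrite big_cons Pi.
by apply: multilinear_ext (multilinearD (fk i Pi) IH) => s _; rewrite big_cons Pi.
Qed.

(** The arguments are fixed one at a time from the head by [common_nonzero2]. *)
Lemma multilinear_common2 k f g s t : multilinear k f -> multilinear k g ->
    size s = k -> size t = k -> f s != 0 -> g t != 0 ->
  exists r, [/\ size r = k, f r != 0 & g r != 0].
Proof.
elim: k f g s t => [|k IH] f g s t.
  by move=> _ _ /size0nil -> /size0nil -> f0 g0; exists [::].
case: s => // x s; case: t => // y t /= [f1 f2] [g1 g2] [sk] [tk] fs gt.
have [z [fz gz]] := common_nonzero2 (f1 s sk) (g1 t tk) fs gt.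
have [r [rk fr gr]] := IH _ _ _ _ (f2 z) (g2 z) sk tk fz gz.
by exists (z :: r); rewrite /= rk.
Qed.

Lemma multilinear_common3 k (e : F) f g h s t r : e != 0 -> e != 1 ->
    multilinear k f -> multilinear k g -> multilinear k h ->
    size s = k -> size t = k -> size r = k -> f s != 0 -> g t != 0 -> h r != 0 ->
  exists q, [/\ size q = k, f q != 0, g q != 0 & h q != 0].
Proof.
move=> e0 e1; elim: k f g h s t r => [|k IH] f g h s t r.
  by move=> _ _ _ /size0nil -> /size0nil -> /size0nil -> f0 g0 h0; exists [::].
case: s => // x s; case: t => // y t; case: r => // z r /=.
move=> [f1 f2] [g1 g2] [h1 h2] [sk] [tk] [rk] fs gt hr.
have [w [fw gw hw]] := common_nonzero3 e0 e1 (f1 s sk) (g1 t tk) (h1 r rk) fs gt hr.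
have [q [qk fq gq hq]] := IH _ _ _ _ _ _ (f2 w) (g2 w) (h2 w) sk tk rk fw gw hw.
by exists (w :: q); rewrite /= qk.
Qed.

Lemma vanishing_or_witness k f :
  (forall s, size s = k -> f s = 0) \/ (exists s, size s = k /\ f s != 0).
Proof.
have [w|w] := classic (exists s, size s = k /\ f s != 0); [by right | left=> s sk].
by apply/eqP/negPn/negP => nz; apply: w; exists s.
Qed.

(** By induction each first argument has its own factor; a tail on which two of these forms are both
    nonzero shows that their factors agree. *)
Lemma proportional_multilinear k f g : multilinear k f -> multilinear k g ->
    (forall s, size s = k -> (f s != 0) = (g s != 0)) ->
  exists c, c != 0 /\ forall s, size s = k -> f s = c * g s.
Proof.
elim: k f g => [|k IH] f g.
  move=> _ _ /(_ [::] erefl) fg; have [g0|g0] := eqVneq (g [::]) 0.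
    exists 1; split=> [|s /size0nil ->]; first exact: oner_neq0.
    by move: fg; rewrite g0 eqxx => /negbFE/eqP ->; rewrite mulr0.
  exists (f [::] / g [::]); split=> [|s /size0nil ->]; last by rewrite divfK.
  by rewrite mulf_neq0 ?invr_eq0 // fg.
move=> /= [f1 f2] [g1 g2] fg.
have fgx x s : size s = k -> (f (x :: s) != 0) = (g (x :: s) != 0).
  by move=> sk; apply: fg; rewrite /= sk.
case: (vanishing_or_witness k.+1 g) => [g0|[[|x0 s0] [] // [s0k] g0]].
  exists 1; split=> [|s sk]; first exact: oner_neq0.
  by apply/eqP; rewrite g0 // mulr0; apply/negPn; rewrite fg // g0 // eqxx.
have [c [c0 fc]] := IH _ _ (f2 x0) (g2 x0) (fgx x0).
exists c; split=> // -[|x s] // [sk].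
case: (vanishing_or_witness k (fun s => g (x :: s))) => [gx|[t [tk gt]]].
  by apply/eqP; rewrite gx // mulr0; apply/negPn; rewrite fgx // gx // eqxx.
have [r [rk gr0 grx]] := multilinear_common2 (g2 x0) (g2 x) s0k tk g0 gt.
have [d [d0 fd]] := IH _ _ (f2 x) (g2 x) (fgx x).
have := proportional_forms (f1 r rk) (g1 r rk) (fgx^~ r ^~ rk) gr0 x.
by rewrite fc // mulfK // fd // => /(mulIf grx) <-; exact: fd.
Qed.

End MultilinearForms.

(** * From a non-vanishing pattern to a multilinear form *)

Section NonvanishingPattern.
Variable F : fieldType.

(** Axioms for the non-vanishing set of an alternating multilinear form. Linearity is asked of the
    first argument only, since symmetry carries it to the others. *)
Definition alternating_pattern (V : lmodType F) k (N : seq V -> bool) : Prop :=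
  [/\ forall s t, size s = k -> perm_eq s t -> N s = N t,
      forall x s, (size s).+2 = k -> ~~ N [:: x, x & s] &
      forall s, (size s).+1 = k ->
        exists A : V -> F, scalar A /\ forall x, N (x :: s) = (A x != 0)].

Lemma perm_swap12 (T : eqType) (x y : T) s : perm_eq [:: x, y & s] [:: y, x & s].
Proof. exact/permPl/(perm_catCA [:: x] [:: y] s). Qed.

Lemma alternating_pattern_cons (V : lmodType F) k (N : seq V -> bool) x :
  alternating_pattern k.+1 N -> alternating_pattern k (fun s => N (x :: s)).
Proof.
case=> Np Na Nl; split=> [s t sk st|y s sk|s sk].
- by apply: Np; rewrite /= ?sk // perm_cons.
- rewrite (Np _ [:: y, y & x :: s]) /= ?sk ?Na //= ?sk //.
  exact/permPl/(perm_catCA [:: x] [:: y; y] s).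
- have [|A [hA NA]] := Nl (x :: s); first by rewrite /= sk.
  exists A; split=> // y; rewrite -NA; apply: Np; first by rewrite /= sk.
  exact: perm_swap12.
Qed.

(* The vector a x - b z + c v is chosen orthogonal to both v and z, hence to x. *)
Lemma skew_of_symmetric_zeros (V : lmodType F) (A : V -> V -> F) v z x :
    (forall w, scalar (A w)) -> (forall w y, (A w y != 0) = (A y w != 0)) ->
    (forall w, A w w = 0) ->
    A z v = - A v z -> A x v = - A v x -> A v z != 0 -> A v x != 0 ->
  A z x = - A x z.
Proof.
move=> hA sA A0 zv xv nz nx.
have sA0 w y : A w y = 0 -> A y w = 0.
  by move=> wy; apply/eqP/negPn; rewrite sA wy eqxx.
pose c := A z x; pose y := A v z *: x + (- A v x *: z + c *: v).
have yE w : A w y = A v z * A w x - A v x * A w z + c * A w v.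
  by rewrite /y hA hA scalar_formZ // mulNr addrA.
have yv : A y v = 0 by apply: sA0; rewrite yE A0 mulr0 addr0 mulrC subrr.
have yz : A y z = 0 by apply: sA0; rewrite yE A0 zv -/c mulr0 subr0 mulrN mulrC subrr.
have := A0 y; rewrite yE yz yv !mulr0 subr0 addr0 => /eqP.
rewrite mulf_eq0 (negPf nz) => /eqP/sA0; rewrite yE A0 xv mulr0 add0r => h.
apply: (mulfI nx); apply/eqP; rewrite -subr_eq0 -/c; apply/eqP.
by rewrite -[RHS]oppr0 -h; ring.
Qed.

(** * Gluing the forms obtained by fixing the first argument *)

Section Step.
Variables (m k : nat) (N : seq 'rV[F]_m -> bool).
Local Notation V := 'rV[F]_m.
Hypothesis pN : alternating_pattern k.+2 N.
Variables (f : V -> seq V -> F) (v0 v1 : V) (s1 : seq V).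
Hypothesis f_lin : forall x, multilinear k.+1 (f x).
Hypothesis f_N : forall x s, size s = k.+1 -> (f x s != 0) = N (x :: s).
Hypothesis s1k : size s1 = k.
Local Notation C x := (f v0 (x :: s1)).
Hypothesis Cv1 : C v1 != 0.
(** [N] determines [f x] only up to a nonzero scalar; this fixes the scalar, by means of the single
    tail [s1]. *)
Hypothesis f_norm : forall x, C x != 0 -> f x (v0 :: s1) = - C x.

Let f1 x s : size s = k -> scalar (fun y => f x (y :: s)).
Proof. by move=> sk; case: (f_lin x) => [f1 _]; exact: f1. Qed.

Let f2 x y : multilinear k (fun s => f x (y :: s)).
Proof. by case: (f_lin x) => _; exact. Qed.

Lemma zeros_swap x y s : size s = k -> (f x (y :: s) != 0) = (f y (x :: s) != 0).
Proof.
move=> sk; rewrite !f_N /= ?sk //; case: pN => Np _ _.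
by apply: Np; rewrite /= ?sk // perm_swap12.
Qed.

Lemma zeros_diag x s : size s = k -> f x (x :: s) = 0.
Proof.
by move=> sk; apply/eqP/negPn; rewrite f_N /= ?sk //; case: pN => _ Na _; apply: Na; rewrite sk.
Qed.

(** Both sides are forms in [s] with the same zeros, hence proportional; their values at [s1] give
    the factor. *)
Lemma skew_base x s : C x != 0 -> size s = k -> f x (v0 :: s) = - f v0 (x :: s).
Proof.
move=> Cx sk; have [c [c0 fc]] := proportional_multilinear (f2 x v0) (f2 v0 x)
  (fun s => zeros_swap x v0 (s := s)).
have := fc s1 s1k; rewrite f_norm // -mulN1r => /(mulIf Cx) cE.
by rewrite fc // -cE mulN1r.
Qed.

(** The two sides are proportional as forms in [s]. The factor is found from
    [skew_of_symmetric_zeros], with [v0] as reference, at a tail where the three values involved are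
    nonzero. *)
Lemma skew_off_kernel x z s : C x != 0 -> C z != 0 -> size s = k ->
  f z (x :: s) = - f x (z :: s).
Proof.
move=> Cx Cz sk; have [c [c0 fc]] := proportional_multilinear (f2 z x) (f2 x z)
  (fun s => zeros_swap z x (s := s)).
case: (vanishing_or_witness k (fun s => f x (z :: s))) => [h0|[r [rk fr]]].
  by rewrite fc // h0 // mulr0 oppr0.
suff cE : c = -1 by rewrite fc // cE mulN1r.
(* The common tail [t] requires a third field element; over two elements every nonzero scalar equals
   [1 = -1]. *)
have [[u [u0 u1]]|noF] := classic (exists u : F, u != 0 /\ u != 1).
  have [t [tk tx tz txz]] := multilinear_common3 u0 u1 (f2 v0 x) (f2 v0 z) (f2 x z)
    s1k s1k rk Cx Cz fr.
  have := @skew_of_symmetric_zeros _ (fun w y => f w (y :: t)) v0 z x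
    (fun w => @f1 w t tk) (fun w y => @zeros_swap w y t tk) (fun w => @zeros_diag w t tk)
    (skew_base Cz tk) (skew_base Cx tk) tz tx.
  by rewrite /= fc // -[- f x _]mulN1r => /(mulIf txz).
have F2 (u : F) : u != 0 -> u = 1.
  by move=> nz; apply/eqP/negPn/negP => n1; apply: noF; exists u.
by rewrite (F2 c) // (F2 (-1)) // oppr_eq0 oner_neq0.
Qed.

(* Vectors in the kernel of C are shifted by v1 to leave it. *)
Let H i (s : seq V) : F :=
  let e := delta_mx 0 i in
  if C e != 0 then f e s else f (e + v1) s - f v1 s.

(** Linear in [z] by construction. [G (z :: s)] need not equal [f z s]; only the zeros of the two
    will be compared. *)
Let G (s : seq V) : F := if s is z :: s' then \sum_i z 0 i * H i s' else 0.

Let H_lin i : multilinear k.+1 (H i).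
Proof.
rewrite /H; have [_|_] := boolP (C (delta_mx 0 i) != 0); first exact: f_lin.
apply: multilinearD; first exact: f_lin.
by apply: multilinear_ext (multilinearZ (-1) (f_lin v1)) => s _; rewrite mulN1r.
Qed.

(** In the shifted case the two contributions of [v1] cancel. *)
Let H_skew i x s : C x != 0 -> size s = k -> H i (x :: s) = - f x (delta_mx 0 i :: s).
Proof.
move=> Cx sk; rewrite /H; case: ifP => [Ce|/negbFE/eqP Ce]; first exact: skew_off_kernel.
have Cev : C (delta_mx 0 i + v1) != 0.
  by rewrite (scalar_formD _ _ (f1 v0 s1k)) Ce add0r.
rewrite (skew_off_kernel Cx Cev sk) (skew_off_kernel Cx Cv1 sk) (scalar_formD _ _ (f1 x sk)) opprD opprK.
by rewrite -addrA addNr addr0.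
Qed.

Let G_skew z x s : C x != 0 -> size s = k -> G [:: z, x & s] = - f x (z :: s).
Proof.
move=> Cx sk; rewrite [z in RHS]row_sum_delta (scalar_form_sum _ _ _ (f1 x sk)) /=.
rewrite -sumrN; apply: eq_bigr => i _.
by rewrite (scalar_formZ _ _ (f1 x sk)) H_skew // mulrN.
Qed.

(** By [G_skew] and [zeros_swap], [G] and [f z] have the same zeros as long as [C x] is nonzero.
    Both are linear in the second argument [x], so [same_zeros_off_kernel] removes this
    restriction. *)
Lemma pattern_step :
  exists g, multilinear k.+2 g /\ forall s, size s = k.+2 -> (g s != 0) = N s.
Proof.
have GS z : multilinear k.+1 (fun s => G (z :: s)).
  by apply: multilinear_sum => i _; apply: multilinearZ.
exists G; split.
  split=> // s sk a x y /=; rewrite mulr_sumr -big_split /=.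
  by apply: eq_bigr => i _; rewrite !mxE mulrDl mulrA.
case=> [|z [|x s]] // [sk]; rewrite -f_N /= ?sk //.
have hG : scalar (fun x => G [:: z, x & s]) by case: (GS z) => [G1 _]; exact: G1.
apply: (same_zeros_off_kernel hG (f1 z sk) (f1 v0 s1k) Cv1) => y Cy.
by rewrite G_skew // oppr_eq0 zeros_swap.
Qed.

End Step.

Lemma pattern_form m k (N : seq 'rV[F]_m -> bool) : alternating_pattern k.+1 N ->
  exists f, multilinear k.+1 f /\ forall s, size s = k.+1 -> (f s != 0) = N s.
Proof.
elim: k N => [|k IH] N pN.
  have [_ _ /(_ [::] erefl) [A [hA NA]]] := pN.
  exists (fun s => A (head 0 s)); split; first by split=> // -[].
  by case=> [|x [|y s]].
pose ex x := IH _ (alternating_pattern_cons x pN).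
pose f x := sval (constructive_indefinite_description _ (ex x)).
have f_lin x : multilinear k.+1 (f x).
  by rewrite /f; case: constructive_indefinite_description => ? [].
have f_N x s : size s = k.+1 -> (f x s != 0) = N (x :: s).
  by rewrite /f; case: constructive_indefinite_description => ? [? h] /h.
have [[s0 [s0k Ns]]|N0] := classic (exists s, size s = k.+2 /\ N s); last first.
  exists (fun=> 0); split=> [|s sk]; first exact: multilinear0.
  by rewrite eqxx; apply/esym/negP => Ns; apply: N0; exists s.
(* One tuple of the pattern supplies the reference vector [v0], the tail [s1], and [v1] as a vector
   outside the kernel of [f v0 (_ :: s1)]. *)
case: s0 s0k Ns => [|v0 [|v1 s1]] // [s1k] Ns.
have [Np Na _] := pN.
(* Where [f v0 (x :: s1)] is nonzero, rescaling by [a x] gives the required normalisation; [f v0]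
   itself is unchanged because [f v0 (v0 :: s1) = 0]. *)
pose a x := if f v0 (x :: s1) == 0 then 1 else - f v0 (x :: s1) / f x (v0 :: s1).
have sw x y : (f x (y :: s1) != 0) = (f y (x :: s1) != 0).
  by rewrite !f_N /= ?s1k //; apply: Np; rewrite /= ?s1k // perm_swap12.
have v0v0 : f v0 (v0 :: s1) = 0.
  by apply/eqP/negPn; rewrite f_N /= ?s1k //; apply: Na; rewrite s1k.
have a_nz x : a x != 0.
  rewrite /a; case: ifPn => nz; first exact: oner_neq0.
  by rewrite mulf_neq0 ?oppr_eq0 // invr_eq0 sw.
have av0 : a v0 = 1 by rewrite /a v0v0 eqxx.
apply: (@pattern_step m k N pN (fun x s => a x * f x s) v0 v1 s1) => //.
- by move=> x; apply: multilinearZ.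
- by move=> x s sk; rewrite mulf_eq0 (negPf (a_nz x)) f_N.
- by rewrite av0 mul1r f_N /= ?s1k.
- move=> x; rewrite av0 !mul1r => nz; rewrite /a (negPf nz) divfK //.
  by rewrite sw.
Qed.

End NonvanishingPattern.

(** * Alternating forms under permutation of the arguments *)

Section AlternatingForms.
Variables (F : fieldType) (V : lmodType F) (k : nat).
Implicit Types (d : seq V -> F) (p q s t : seq V) (x y : V).

Lemma multilinearP j d : multilinear j d <->
  forall p q, (size p + size q).+1 = j -> scalar (fun x => d (p ++ x :: q)).
Proof.
elim: j d => [|j IH] d //=; split=> [[d1 d2] [|y p] q /= [sz]|h].
- exact: d1.
- exact: (IH (fun s => d (y :: s))).1.
split=> [s sk|x]; first by apply: (h [::]); rewrite sk.
by apply/IH => p q sz; apply: (h (x :: p)); rewrite /= addSn sz.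
Qed.

Definition alternating d := forall s, size s = k -> ~~ uniq s -> d s = 0.

Variable d : seq V -> F.
Hypotheses (d_lin : multilinear k d) (d_alt : alternating d).

Lemma alternating_swap p q x y : size (p ++ [:: x, y & q]) = k ->
  d (p ++ [:: x, y & q]) = - d (p ++ [:: y, x & q]).
Proof.
rewrite size_cat /= => sz.
have d0 z : d (p ++ [:: z, z & q]) = 0.
  apply: d_alt; first by rewrite size_cat.
  by rewrite cat_uniq /= in_cons eqxx /= !andbF.
have l1 z : scalar (fun w => d (p ++ [:: w, z & q])).
  by apply: ((multilinearP _ _).1 d_lin p (z :: q)); rewrite -sz addnS.
have l2 z : scalar (fun w => d (p ++ [:: z, w & q])).
  move=> a u w /=; have := (multilinearP _ _).1 d_lin (p ++ [:: z]) q.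
  rewrite size_cat /= => /(_ _ a u w); rewrite -!catA; apply.
  by rewrite -sz addn1 addSn !addnS.
have := d0 (x + y); rewrite (scalar_formD _ _ (l1 _)) !(scalar_formD _ _ (l2 _)) !d0.
by rewrite add0r addr0 => /eqP; rewrite addr_eq0 => /eqP.
Qed.

(** Following only the vanishing of [d], not its value, avoids the signs of permutations. *)
Lemma alternating_zero_move p x s q : size (p ++ x :: s ++ q) = k ->
  d (p ++ x :: s ++ q) = 0 -> d (p ++ s ++ x :: q) = 0.
Proof.
elim: s p => //= y s IH p sz; rewrite alternating_swap // => /eqP; rewrite oppr_eq0 => /eqP h.
have := IH (rcons p y); rewrite !cat_rcons; apply=> //.
by rewrite -sz !size_cat /= !size_cat /= !addnS.
Qed.

Lemma alternating_zero_catCA p s t q : size (p ++ s ++ t ++ q) = k ->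
  d (p ++ s ++ t ++ q) = 0 -> d (p ++ t ++ s ++ q) = 0.
Proof.
elim: s p => //= x s IH p sz h.
apply: alternating_zero_move; last first.
  by have := IH (rcons p x); rewrite !cat_rcons; apply.
by rewrite -sz !size_cat /= !size_cat [in RHS]addnCA.
Qed.

Lemma alternating_zero_perm s t : perm_eq s t -> size s = k -> d s = 0 -> d t = 0.
Proof.
move=> st sk ds.
suff [] : size t = k /\ d t = 0 by [].
apply: (catCA_perm_ind (P := fun r => size r = k /\ d r = 0)) st _ => // s1 s2 s3 [sz h].
split; first by rewrite -sz !size_cat addnCA.
exact: (alternating_zero_catCA (p := [::])).
Qed.

End AlternatingForms.

Lemma dup_perm (T : eqType) (s : seq T) :
  ~~ uniq s -> exists x r, perm_eq s [:: x, x & r].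
Proof.
elim: s => //= x s IH; rewrite negb_and negbK.
have [xs _|_ /= /IH[y [r sr]]] := boolP (x \in s).
  by exists x, (rem x s); rewrite perm_cons perm_to_rem.
exists y, (x :: r); rewrite -(perm_cons x) in sr; apply: perm_trans sr _.
exact/permPl/(perm_catCA [:: x] [:: y; y] r).
Qed.

(** Symmetry brings a repeated vector to the two front places. *)
Lemma pattern_alternating (F : fieldType) (V : lmodType F) k (N : seq V -> bool) f :
    alternating_pattern k N -> (forall s, size s = k -> (f s != 0 :> F) = N s) ->
  alternating k f.
Proof.
case=> Np Na _ fN s sk /dup_perm[x [r sr]]; apply/eqP/negPn; rewrite fN // (Np _ _ sk sr).
by apply: Na; rewrite -sk (perm_size sr).
Qed.

(** * Expansion of alternating forms in minors *)

Section Minors.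
Variables (F : fieldType) (n k : nat).
Local Notation V := 'rV[F]_n.+1.
Local Notation e := (fun j : 'I_n.+1 => delta_mx 0 j : V).

(** At [k = h.+1] and [s = vbasis X] this is [plucker X S]; a free [s] allows multilinearity to be
    stated. *)
Definition minor (S : {set 'I_n.+1}) (s : seq V) : F :=
  \det (\matrix_(i < k, j < k) ((nth 0 s i) 0 (nth ord0 (enum S) j))).

Lemma minor_multilinear S : multilinear k (minor S).
Proof.
apply/multilinearP => p q sz a x y; rewrite /minor.
have pk : (size p < k)%N by rewrite -sz ltnS leq_addr.
rewrite -[X in _ = _ + X]mul1r.
apply: (determinant_multilinear (i0 := Ordinal pk)).
- apply/rowP => j; rewrite !mxE /= !nth_cat ltnn subnn /= !mxE.
  by rewrite mul1r.
- apply/matrixP => i j; rewrite !mxE !nth_cat; case: ltnP => // le_pi.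
  have : (lift (Ordinal pk) i : nat) != size p.
    by rewrite eq_sym (neq_lift (Ordinal pk) i).
  by move: (lift _ _ : nat) le_pi => l; case: ltngtP => // lt _ _; rewrite -subn_gt0 in lt; case: (l - _)%N lt.
- apply/matrixP => i j; rewrite !mxE !nth_cat; case: ltnP => // le_pi.
  have : (lift (Ordinal pk) i : nat) != size p.
    by rewrite eq_sym (neq_lift (Ordinal pk) i).
  by move: (lift _ _ : nat) le_pi => l; case: ltngtP => // lt _ _; rewrite -subn_gt0 in lt; case: (l - _)%N lt.
Qed.

Lemma minor_alternating S : alternating k (minor S).
Proof.
move=> s sk /(uniqPn 0)[i [j [ij js eq]]]; rewrite sk in js.
apply: (determinant_alternate (i1 := Ordinal (ltn_trans ij js)) (i2 := Ordinal js)).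
  by rewrite -val_eqE /= ltn_eqF.
by move=> l; rewrite !mxE eq.
Qed.

Lemma minor_basis (S T : {set 'I_n.+1}) : #|S| = k -> #|T| = k ->
  minor S (map e (enum T)) = (S == T)%:R.
Proof.
move=> Sk Tk; have [<-|neST] := eqVneq S T.
  rewrite -(det1 F k); congr (\det _); apply/matrixP => i j; rewrite !mxE.
  rewrite (nth_map ord0) -?cardE ?Sk // !mxE eqxx /= nth_uniq -?cardE ?Sk ?enum_uniq //.
  by rewrite eq_sym.
(* An index [t] of [T] outside [S] yields a zero row. *)
have /subsetPn[t tT tS] : ~~ (T \subset S).
  by apply: contra neST => sTS; rewrite eq_sym eqEcard sTS Sk Tk /=.
have tk : (index t (enum T) < k)%N by rewrite -Tk cardE index_mem mem_enum.
rewrite /minor (expand_det_row _ (Ordinal tk)) big1 // => j _.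
rewrite !mxE (nth_map ord0) -?cardE ?Tk //= nth_index ?mem_enum // !mxE eqxx /=.
case: eqP => [tE|_]; last by rewrite mul0r.
by case/negP: tS; rewrite -mem_enum -tE mem_nth // -cardE Sk.
Qed.

Lemma multilinear_zero_basis j (d : seq V -> F) : multilinear j d ->
  (forall I, size I = j -> d (map e I) = 0) -> forall s, size s = j -> d s = 0.
Proof.
elim: j d => [|j IH] d; first by move=> _ h s /size0nil ->; apply: (h [::]).
move=> [d1 d2] h [|x s] // [sj]; rewrite [x]row_sum_delta (scalar_form_sum _ _ _ (d1 s sj)).
apply: big1 => i _; rewrite (scalar_formZ _ _ (d1 s sj)).
by rewrite (IH _ (d2 _)) ?mulr0 // => I Ij; apply: (h (i :: I)); rewrite /= Ij.
Qed.

(** The difference of the two sides is multilinear and alternating, so basis tuples decide. A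
    repeated index gives 0; distinct indices can be reordered to [enum T], where only the minor of
    [T] survives. *)
Lemma alternating_minors (f : seq V -> F) : multilinear k f -> alternating k f ->
  forall s, size s = k ->
    f s = \sum_(S : {set 'I_n.+1} | #|S| == k) f (map e (enum S)) * minor S s.
Proof.
move=> f_lin f_alt s sk; apply/eqP; rewrite -subr_eq0; apply/eqP.
pose d s := f s + -1 * \sum_(S : {set 'I_n.+1} | #|S| == k) f (map e (enum S)) * minor S s.
have d_lin : multilinear k d.
  apply/multilinearD/multilinearZ/multilinear_sum => // S _.
  exact/multilinearZ/minor_multilinear.
have d_alt : alternating k d.
  move=> r rk rU; rewrite /d f_alt // add0r big1 ?mulr0 // => S _.
  by rewrite minor_alternating ?mulr0.
suff : d s = 0 by rewrite /d mulN1r.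
apply: (multilinear_zero_basis d_lin) sk => I Ik.
have [uI|nI] := boolP (uniq I); last first.
  apply: d_alt; first by rewrite size_map.
  by apply: contra nI; apply: map_uniq.
pose T := [set i in I].
have IT : perm_eq (enum T) I.
  by apply: uniq_perm; rewrite ?enum_uniq // => i; rewrite mem_enum inE.
have Tk : #|T| = k by rewrite cardE (perm_size IT).
apply: (alternating_zero_perm d_lin d_alt (perm_map e IT)).
  by rewrite size_map -cardE.
rewrite /d (bigD1 T) ?Tk //= minor_basis // eqxx mulr1 big1 ?addr0 ?mulN1r ?subrr //.
by move=> S /andP[/eqP Sk nST]; rewrite minor_basis // (negPf nST) mulr0.
Qed.

End Minors.

(** * Hyperplanes inside a subspace, in vector dimensions *)

Section Subspaces.
Variables (F : fieldType) (vT : vectType F).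
Implicit Types (U W X E : {vspace vT}) (x w : vT).

Lemma dim_add_line U x : x \notin U -> \dim (U + <[x]>) = (\dim U).+1.
Proof.
move=> xU; have x0 : x != 0 by apply: contraNneq xU => ->; apply: mem0v.
rewrite dimv_disjoint_sum ?dim_vline ?x0 ?addn1 //; apply/eqP; rewrite -subv0.
apply/subvP => v; rewrite memv_cap => /andP[vU /vlineP[a vE]]; move: vU; rewrite vE.
by rewrite rpredZeq (negPf xU) orbF => /eqP ->; rewrite scale0r mem0v.
Qed.

Lemma dim_lt_witness U W : (\dim U < \dim W)%N -> exists2 x, x \in W & x \notin U.
Proof. by move=> lt; apply/subvPn; apply: contraL lt => /dimvS; rewrite -leqNgt. Qed.

Lemma same_dim_witness U W : \dim U = \dim W -> U != W -> exists2 x, x \in U & x \notin W.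
Proof.
by move=> dUW neq; apply/subvPn; apply: contra neq => sUW; rewrite eqEdim sUW dUW /=.
Qed.

Lemma add_hyperplanes h X U W : \dim X = h.+1 -> \dim U = h -> \dim W = h ->
  (U <= X)%VS -> (W <= X)%VS -> U != W -> (U + W)%VS = X.
Proof.
move=> dX dU dW UX WX neq.
have [x xU xW] := same_dim_witness (etrans dU (esym dW)) neq.
apply/eqP; rewrite eqEdim subv_add UX WX dX -dW -(dim_add_line xW).
by apply: dimvS; rewrite addvC addvS // -memvE.
Qed.

Lemma cap_hyperplanes h X U W : \dim X = h.+1 -> \dim U = h -> \dim W = h ->
  (U <= X)%VS -> (W <= X)%VS -> U != W -> \dim (U :&: W) = h.-1.
Proof.
move=> dX dU dW UX WX neq; have := dimv_sum_cap U W.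
rewrite (add_hyperplanes dX dU dW UX WX neq) dX dU dW.
by case: h {dX dU dW} => // h; rewrite addSnnS => /addnI [].
Qed.

(** Add to [U :&: W] the sum of a vector of [U] outside [W] and a vector of [W] outside [U]; this
    works over every field. *)
Lemma third_hyperplane h X U W : (0 < h)%N -> \dim X = h.+1 -> \dim U = h -> \dim W = h ->
    (U <= X)%VS -> (W <= X)%VS -> U != W ->
  exists Y, [/\ \dim Y = h, (U :&: W <= Y)%VS, (Y <= X)%VS, Y != U & Y != W].
Proof.
move=> h0 dX dU dW UX WX neq; have dS := cap_hyperplanes dX dU dW UX WX neq.
have [x xU xW] := same_dim_witness (etrans dU (esym dW)) neq.
have [y yW yU] : exists2 y, y \in W & y \notin U.
  by apply: same_dim_witness; rewrite ?dU ?dW // eq_sym.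
have xyU : x + y \notin U by rewrite rpredDl.
have xyW : x + y \notin W by rewrite rpredDr.
exists (U :&: W + <[x + y]>)%VS.
have xyY : x + y \in (U :&: W + <[x + y]>)%VS by rewrite memvE addvSr.
split.
- by rewrite dim_add_line ?memv_cap ?(negPf xyU) // dS prednK.
- exact: addvSl.
- rewrite subv_add (subv_trans (capvSl _ _) UX) -memvE.
  exact: memvD (subvP UX _ xU) (subvP WX _ yW).
- by apply: contraNneq xyU => <-.
- by apply: contraNneq xyW => <-.
Qed.

(** The form is the first coordinate in a basis made of a vector outside [E] followed by a basis of
    [E]. *)
Lemma hyperplane_form E : (\dim E).+1 = \dim {:vT} ->
  exists A : vT -> F, scalar A /\ forall x, (A x != 0) = (x \notin E).
Proof.
move=> dE; have [w _ wE] : exists2 w, w \in fullv & w \notin E.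
  by apply: dim_lt_witness; rewrite -dE.
pose X := [tuple of w :: vbasis E].
have fX : free X by rewrite free_cons (span_basis (vbasisP E)) wE (basis_free (vbasisP E)).
have bX : basis_of fullv X by rewrite basisEfree fX subvf size_tuple dE /=.
exists (coord X ord0); split; first by move=> a u v; rewrite linearP.
move=> x; rewrite -[in RHS](negbK (x \in E)) negbK; congr negb; apply/eqP/idP => [x0|xE].
  rewrite (coord_basis bX (memvf x)) big_ord_recl x0 scale0r add0r.
  apply: memv_suml => i _; apply: memvZ; apply: (vbasis_mem (U := E)).
  have -> : X`_(lift ord0 i) = (vbasis E)`_i by [].
  by apply: mem_nth; rewrite size_tuple.
rewrite (coord_vbasis xE) linear_sum big1 // => i _; rewrite linearZ /=.
have -> : (vbasis E)`_i = X`_(lift ord0 i) by [].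
by rewrite coord_free // mulr0.
Qed.

End Subspaces.

(** * The pattern of a null linear mapping *)

Section NullLinearMapping.
Variables (F : fieldType) (n h : nat).
Local Notation V := 'rV[F]_n.+1.
Local Notation sub := {vspace V}.
Variable chi : sub -> option sub.
Hypothesis h_gt0 : (1 <= h)%N.
Hypothesis chi_dim : forall U E, \dim U = h -> chi U = Some E -> \dim E = n.
Hypothesis chi_lin : @linear_mapping F n h chi.
Hypothesis chi_null : forall U E, \dim U = h -> chi U = Some E -> (U <= E)%VS.

Definition good (U X : sub) : bool := if chi U is Some E then (X <= E)%VS else true.

(* On the pencil spanned by U and W, a third point is needed in each case. *)
Lemma good_transfer X U W : \dim X = h.+1 -> \dim U = h -> \dim W = h ->
  (U <= X)%VS -> (W <= X)%VS -> good U X -> good W X.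
Proof.
move=> dX dU dW UX WX; have [<- //|neq] := eqVneq U W.
have [Y [dY SY YX YU YW]] := third_hyperplane h_gt0 dX dU dW UX WX neq.
pose S := (U :&: W)%VS.
have SX : (S <= X)%VS := subv_trans (capvSl _ _) UX.
have line : @gline F n h S X by rewrite /gline (cap_hyperplanes dX dU dW UX WX neq).
have pU : @pencil F n h S X U by rewrite /pencil capvSl.
have pW : @pencil F n h S X W by rewrite /pencil capvSr.
have pY : @pencil F n h S X Y by [].
case: (chi_lin line) => [[|[|]]] + _.
- move=> [T [dT [chiT [inj _]]]].
  have [E [cE TE]] := chiT U pU.
  rewrite /good cE => XE.
  (* The image [D] of [Z] differs from [E] by injectivity, so [T] is their intersection; [Z] lies in
     [D] by the null property and in [E] through [X]. Applied to [W] and [Y], this puts their sum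
     [X] inside [T]. *)
  have inT Z : pencil h S X Z -> Z != U -> (Z <= T)%VS.
    move=> pZ neZ; have [D [cD TD]] := chiT Z pZ; have [dZ [_ ZX]] := pZ.
    have neD : D != E.
      by apply: contra neZ => /eqP DE; apply/eqP/(inj Z U D) => //; rewrite DE.
    have dE := chi_dim dU cE; have dD := chi_dim dZ cD.
    have TE_DE : T = (D :&: E)%VS.
      have := cap_hyperplanes (X := fullv) _ dD dE (subvf _) (subvf _) neD.
      rewrite dimvf /= /dim /= mul1n => /(_ erefl) dDE.
      by apply/eqP; rewrite eqEdim subv_cap TD TE dDE dT /=.
    by rewrite TE_DE subv_cap (chi_null dZ cD) (subv_trans ZX).
  have [E' [cE' TE']] := chiT W pW; rewrite cE'.
  rewrite -(add_hyperplanes dX dW dY WX YX _) 1?eq_sym // subv_add.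
  by rewrite !(subv_trans _ TE') ?inT // eq_sym.
- move=> [[E [_ cst]] [X0 [_ [_ X0u]]]] _; rewrite /good.
  case cW: (chi W) => [E'|] //.
  have E'E := cst _ _ pW cW; subst E'.
  (* Only one member of the pencil is exceptional, so [U] or [Y] has the value [E]. Then [X], the
     sum of [W] and that member, lies in [E]. *)
  have [Z [dZ ZX neZ cZ]] : exists Z, [/\ \dim Z = h, (Z <= X)%VS, W != Z & chi Z = Some E].
    case cU: (chi U) => [E1|]; last case cY: (chi Y) => [E1|].
    - by exists U; rewrite -(cst _ _ pU cU) eq_sym.
    - by exists Y; rewrite -(cst _ _ pY cY) eq_sym.
    - by move: YU; rewrite (X0u _ pU cU) (X0u _ pY cY) eqxx.
  by rewrite -(add_hyperplanes dX dW dZ WX ZX neZ) subv_add (chi_null dW cW) (chi_null dZ cZ).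
- by move=> none _; rewrite /good (none W pW).
Qed.

Definition chi_pattern (s : seq V) : bool := free s && ~~ good <<behead s>>%VS <<s>>%VS.

Lemma free_behead (s : seq V) : free s -> free (behead s).
Proof. by case: s => // x s; rewrite free_cons => /andP[]. Qed.

Lemma span_behead (s : seq V) : (<<behead s>> <= <<s>>)%VS.
Proof. by case: s => // x s; rewrite span_cons addvSr. Qed.

Lemma dim_span_behead (s : seq V) : free s -> size s = h.+1 -> \dim <<behead s>> = h.
Proof. by move=> /free_behead/eqP -> sz; rewrite size_behead sz. Qed.

(** Both tails span hyperplanes of the same span, so [good_transfer] applies in both directions. *)
Lemma good_span_perm s t : free s -> size s = h.+1 -> perm_eq s t ->
  good <<behead s>>%VS <<s>>%VS = good <<behead t>>%VS <<t>>%VS.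
Proof.
move=> fs sz st; have ft : free t by rewrite -(perm_free st).
have szt : size t = h.+1 by rewrite -(perm_size st).
have <- : <<s>>%VS = <<t>>%VS by apply/eq_span/perm_mem.
have dX : \dim <<s>> = h.+1 by rewrite (eqP fs).
have tX : (<<behead t>> <= <<s>>)%VS.
  by rewrite (eq_span (perm_mem st)) span_behead.
apply/idP/idP; apply: good_transfer; rewrite ?dim_span_behead ?span_behead //.
Qed.

Lemma chi_pattern_alternating : alternating_pattern h.+1 chi_pattern.
Proof.
split=> [s t sz st|x s _|s [sz]].
- rewrite /chi_pattern -(perm_free st); case: (boolP (free s)) => //= fs.
  by rewrite (good_span_perm fs sz st).
- by rewrite /chi_pattern free_cons memv_span ?mem_head.
have zero : (forall x, chi_pattern (x :: s) = false) ->
    exists A : V -> F, scalar A /\ forall x, chi_pattern (x :: s) = (A x != 0).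
  move=> N0; exists (fun=> 0); split=> [a x y|x]; first by rewrite mulr0 addr0.
  by rewrite N0 eqxx.
case fs: (free s); last first.
  by apply: zero => x; rewrite /chi_pattern free_cons fs andbF.
case cs: (chi <<s>>) => [E|]; last first.
  by apply: zero => x; rewrite /chi_pattern /good /= cs andbF.
have ds : \dim <<s>> = h by rewrite (eqP fs).
have [|A [hA AE]] := @hyperplane_form F V E.
  by rewrite (chi_dim ds cs) dimvf /= /dim /= mul1n.
(* By the null property a vector outside [E] is outside [<<s>>], so freeness is automatic there. *)
exists A; split=> // x; rewrite AE /chi_pattern /good /= cs free_cons fs andbT.
rewrite span_cons subv_add (chi_null ds cs) andbT -memvE.
by case: (boolP (x \in E)) => xE; rewrite ?andbF // andbT; apply: contra xE; apply/subvP/chi_null.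
Qed.

End NullLinearMapping.

(** * Existence and uniqueness of the linear complex *)

Theorem theorem5p6 (F : fieldType) (n h : nat)
    (chi : {vspace 'rV[F]_n.+1} -> option {vspace 'rV[F]_n.+1}) :
  (1 <= h)%N -> (h <= n - 1)%N ->
  (forall U E, \dim U = h -> chi U = Some E -> \dim E = n) ->
  @linear_mapping F n h chi ->
  (exists U, \dim U = h /\ chi U <> None) ->
  (forall U E, \dim U = h -> chi U = Some E -> (U <= E)%VS) ->
  exists K : {vspace 'rV[F]_n.+1} -> Prop,
    @linear_complex F n h K /\ @is_up F n h chi K /\
    forall K' : {vspace 'rV[F]_n.+1} -> Prop,
      @linear_complex F n h K' -> @is_up F n h chi K' -> forall X, K' X <-> K X.
Proof.
move=> h_gt0 _ chi_dim chi_lin [U0 [dU0 cU0]] chi_null.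
have pN := chi_pattern_alternating h_gt0 chi_dim chi_lin chi_null.
have [f [f_lin f_N]] := pattern_form pN.
have f_alt := pattern_alternating pN f_N.
pose c (S : {set 'I_n.+1}) := f (map (fun j => delta_mx 0 j) (enum S)).
pose K (X : {vspace 'rV[F]_n.+1}) := \dim X = h.+1 /\
  \sum_(S : {set 'I_n.+1} | #|S| == h.+1) c S * @plucker F n h X S = 0.
(* Membership in [K] means that [f] vanishes on [vbasis X], which is goodness for the span of the
   tail of that basis; [good_transfer] passes to any other [U]. *)
have K_good X U : \dim X = h.+1 -> \dim U = h -> (U <= X)%VS -> K X <-> good chi U X.
  move=> dX dU UX; have sX : size (vbasis X) = h.+1 by rewrite size_tuple.
  have fX := basis_free (vbasisP X); have spX := span_basis (vbasisP X).
  rewrite /K -(alternating_minors f_lin f_alt sX).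
  have -> : good chi U X = (f (vbasis X) == 0).
    rewrite -[RHS]negbK f_N // /chi_pattern fX spX negbK.
    have dB := dim_span_behead fX sX; have := span_behead (vbasis X); rewrite spX => BX.
    by apply/idP/idP; apply: (good_transfer h_gt0 chi_dim chi_lin chi_null dX).
  by split=> [[_ ->]|/eqP].
(* Serves both to exclude [c = 0] and to show that [U] is not singular. *)
have extend U E : \dim U = h -> chi U = Some E ->
    exists X, [/\ \dim X = h.+1, (U <= X)%VS & ~~ (X <= E)%VS].
  move=> dU cU; have [w _ wE] : exists2 w, w \in fullv & w \notin E.
    by apply: dim_lt_witness; rewrite (chi_dim U E) // dimvf /= /dim /= mul1n.
  have wU : w \notin U by apply: contra wE; apply/subvP/chi_null.
  exists (U + <[w]>)%VS; split; first by rewrite dim_add_line ?dU.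
    exact: addvSl.
  by rewrite subv_add -memvE (negPf wE) andbF.
exists K; split; [|split].
(* If every [c S] were zero, [K] would contain the [X] that [extend] provides at [U0]. *)
- exists c; split; last by [].
  case cE: (chi U0) cU0 => [E|] // _; have [X [dX UX XE]] := extend U0 E dU0 cE.
  have [S|c0] := classic (exists S : {set 'I_n.+1}, #|S| = h.+1 /\ c S != 0); first by [].
  case/negP: XE; have := (K_good X U0 dX dU0 UX).1; rewrite /good cE; apply.
  split=> //; apply: big1 => S /eqP Sh.
  have [->|cS] := eqVneq (c S) 0; first by rewrite mul0r.
  by case: c0; exists S.
- move=> U dU; case cU: (chi U) => [E|]; split.
  + split=> // sing; have [X [dX UX XE]] := extend U E dU cU.
    case/negP: XE; have := (K_good X U dX dU UX).1; rewrite /good cU; apply; exact: sing.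
  + move=> _ [<-]; split=> [|X dX UX]; first exact: chi_dim cU.
    by rewrite (K_good X U) // /good cU.
  + split=> // _ X dX UX; apply/(K_good X U) => //; by rewrite /good cU.
  + by [].
(* Uniqueness: the tail of a basis of [X] spans a [U] inside [X], and [is_up] at [U] determines from
   [chi U] alone whether [X] belongs to the complex. *)
move=> K' [c' [_ K'E]] upK' X.
have [dX|dX] := eqVneq (\dim X) h.+1; last first.
  by split=> [/K'E[]|[]] dX'; rewrite dX' eqxx in dX.
have sX : size (vbasis X) = h.+1 by rewrite size_tuple.
have dU := dim_span_behead (basis_free (vbasisP X)) sX.
have := span_behead (vbasis X); rewrite (span_basis (vbasisP X)) => UX.
set U := <<behead _>>%VS in dU UX; rewrite (K_good X U) // /good.
have [up0 up1] := upK' U dU; case cU: (chi U) up0 up1 => [E|] up0 up1.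
  by have [_ ->] := up1 E erefl.
by split=> // _; apply: up0.1.
Qed.
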